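(* Let $n\ge 2$. For every unitarily invariant norm $\|\cdot\|$ on $\mathbb{M}_n$ and every $Z\in\mathbb{M}_n$, $$\frac12\,\bigl\||Z|\bigr\|\ \le\ \bigl\||Z|_{\mathrm{sym}}\bigr\|\ \le\ \bigl\||Z|\bigr\|.$$ Moreover, both constants $\tfrac12$ and $1$ are sharp: if $c$ is a real number such that $c\,\||Z|\|\le \||Z|_{\mathrm{sym}}\|$ for every unitarily invariant norm on $\mathbb{M}_n$ and every $Z\in\mathbb{M}_n$, then $c\le \tfrac12$; and if $C$ is a real number such that $\||Z|_{\mathrm{sym}}\|\le C\,\||Z|\|$ for every unitarily invariant norm on $\mathbb{M}_n$ and every $Z\in\mathbb{M}_n$, then $C\ge 1$.
   Context: $\mathbb{M}_n$ is the set of $n\times n$ complex matrices and $Z^*$ is the conjugate transpose of $Z$. The usual modulus is $|Z|:=(Z^*Z)^{1/2}$, and the arithmetic symmetric modulus is $|Z|_{\mathrm{sym}}:=\frac{|Z|+|Z^*|}{2}$. A norm $\|\cdot\|$ on $\mathbb{M}_n$ is unitarily invariant if $\|UZV\|=\|Z\|$ for all $Z\in\mathbb{M}_n$ and all unitaries $U,V\in\mathbb{M}_n$. *)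

(* Defs.v *)
From mathcomp Require Import all_boot all_order all_algebra.
From mathcomp Require Import complex reals.

Set Implicit Arguments.
Unset Strict Implicit.
Unset Printing Implicit Defensive.

Import Order.TTheory GRing.Theory Num.Theory.
Local Open Scope ring_scope.
Local Open Scope sesquilinear_scope.

Section Modulus.
Variables (C : numClosedFieldType) (n : nat).
Implicit Types A B Z : 'M[C]_n.

Definition psdmx A : Prop :=
  A ^t* = A /\ forall u : 'rV[C]_n, 0 <= (u *m A *m u ^t*) 0 0.

(* Square root by the spectral theorem: if A = P^-1 D P with P unitary and D
   diagonal then mxsqrt A = P^-1 D^{1/2} P.  Meaningful for psd A, for which
   mxsqrt_psd, mxsqrtK and mxsqrt_uniq below say that it is the unique psd
   square root. *)
Definition mxsqrt A : 'M[C]_n :=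
  invmx (spectralmx A) *m diag_mx (map_mx sqrtC (spectral_diag A))
    *m spectralmx A.

Definition modulus Z : 'M[C]_n := mxsqrt (Z ^t* *m Z).

Definition sym_modulus Z : 'M[C]_n :=
  2^-1 *: (modulus Z + modulus (Z ^t*)).

Lemma form_row A (P : 'M[C]_n) i :
  (row i P *m A *m (row i P) ^t*) 0 0 = (P *m A *m P ^t*) i i.
Proof.
by rewrite -!row_mul !mxE; apply: eq_bigr => j _; rewrite !mxE.
Qed.

Lemma adjM m p q (A : 'M[C]_(m, p)) (B : 'M[C]_(p, q)) :
  (A *m B) ^t* = B ^t* *m A ^t*.
Proof. by rewrite trmx_mul map_mxM. Qed.

Lemma form_ge0 (u : 'rV[C]_n) : 0 <= (u *m u ^t*) 0 0.
Proof.
by rewrite mxE; apply: sumr_ge0 => j _; rewrite !mxE mul_conjC_ge0.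
Qed.

Lemma psd_gram Z : psdmx (Z ^t* *m Z).
Proof.
split=> [|u]; first by rewrite adjM trmxCK.
have -> : u *m (Z ^t* *m Z) *m u ^t* = (u *m Z ^t*) *m (u *m Z ^t*) ^t*.
  by rewrite adjM trmxCK !mulmxA.
exact: form_ge0.
Qed.

Lemma herm_spectral A : A ^t* = A ->
  A = (spectralmx A) ^t* *m diag_mx (spectral_diag A) *m spectralmx A.
Proof.
move=> hA; have nA : A \is normalmx by apply/normalmxP; rewrite hA.
by rewrite {1}(orthomx_spectralP nA) invmx_unitary ?spectral_unitarymx.
Qed.

Lemma spectral_diagE A i : A ^t* = A ->
  spectral_diag A 0 i =
    (row i (spectralmx A) *m A *m (row i (spectralmx A)) ^t*) 0 0.
Proof.
move=> hA; rewrite form_row; set P := spectralmx A.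
have /unitarymxP PP : P \is unitarymx by exact: spectral_unitarymx.
rewrite [X in P *m X](herm_spectral hA) -/P !mulmxA PP mul1mx -mulmxA PP.
by rewrite mulmx1 !mxE eqxx.
Qed.

Lemma spectral_diag_ge0 A i : psdmx A -> 0 <= spectral_diag A 0 i.
Proof. by case=> hA pA; rewrite spectral_diagE. Qed.

Lemma mxsqrt_psd A : psdmx A -> psdmx (mxsqrt A).
Proof.
move=> pA; rewrite /mxsqrt invmx_unitary ?spectral_unitarymx //.
set P := spectralmx A; set D := map_mx sqrtC _.
have D0 i : 0 <= D 0 i by rewrite mxE sqrtC_ge0 spectral_diag_ge0.
split=> [|u].
  rewrite !adjM trmxCK mulmxA; congr (_ *m _ *m _).
  apply/matrixP=> i j; rewrite [LHS]mxE [X in _ X = _]mxE !(mxE diag_mx_key).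
  case: (eqVneq i j) => [->|_]; last by rewrite !mulr0n rmorph0.
  by rewrite !mulr1n geC0_conj.
have -> : u *m (P ^t* *m diag_mx D *m P) *m u ^t* =
          (u *m P ^t*) *m diag_mx D *m (u *m P ^t*) ^t*.
  by rewrite adjM trmxCK !mulmxA.
move: (u *m _) => v; rewrite mxE; apply: sumr_ge0 => j _.
have := D0 j; rewrite mul_mx_diag !mxE mulrAC => Dj.
by apply: mulr_ge0 => //; rewrite mul_conjC_ge0.
Qed.

Lemma mxsqrtK A : psdmx A -> mxsqrt A *m mxsqrt A = A.
Proof.
move=> pA; rewrite [RHS]herm_spectral; last by case: pA.
rewrite /mxsqrt invmx_unitary ?spectral_unitarymx //.
set P := spectralmx A; set D := map_mx sqrtC _.
have /unitarymxP PP : P \is unitarymx by exact: spectral_unitarymx.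
rewrite !mulmxA -[_ *m P *m P ^t*]mulmxA PP mulmx1.
rewrite -[_ *m diag_mx D *m diag_mx D]mulmxA.
congr (_ *m _ *m _); rewrite mulmx_diag; congr diag_mx.
by apply/rowP=> j; rewrite !mxE -expr2 sqrtCK.
Qed.

Lemma mxsqrt_uniq A B : psdmx B -> B *m B = A -> B = mxsqrt A.
Proof.
move=> pB BA; have pA : psdmx A.
  by have [hB _] := pB; rewrite -BA -{1}hB; exact: psd_gram.
have := mxsqrt_psd pA; have := mxsqrtK pA; move: (mxsqrt A) => S SA pS.
have [[hB B0] [hS S0]] := (pB, pS).
pose D := B - S; have hD : D ^t* = D by rewrite /D !linearB /= map_mxB hB hS.
suff D0 : D = 0 by apply/eqP; rewrite -subr_eq0 -/D D0.
suff d0 : spectral_diag D = 0.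
  by rewrite (herm_spectral hD) d0 (_ : diag_mx 0 = 0) ?linear0 ?mulmx0 ?mul0mx.
apply/rowP=> i; rewrite [RHS]mxE; apply/eqP/negPn/negP => di0.
have di := spectral_diagE i hD.
set P := spectralmx D in di; set d := spectral_diag D 0 i in di di0.
have /unitarymxP PP : P \is unitarymx by exact: spectral_unitarymx.
set u := row i P in di.
have uD : u *m D = d *: u.
  rewrite /u {1}(herm_spectral hD) -/P -row_mul !mulmxA PP mul1mx row_mul.
  by rewrite row_diag_mx -scalemxAl -rowE.
have Du : D *m u ^t* = d^* *: u ^t*.
  rewrite -[D in LHS]hD -adjM uD; apply/matrixP=> k l; rewrite !mxE.
  by rewrite rmorphM.
have dR : d^* = d.
  have : (u *m D *m u ^t*) 0 0 = d^* * (u *m u ^t*) 0 0.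
    by rewrite -mulmxA Du -scalemxAr mxE.
  have : (u *m D *m u ^t*) 0 0 = d * (u *m u ^t*) 0 0.
    by rewrite uD -scalemxAl mxE.
  have -> : (u *m u ^t*) 0 0 = 1.
    by have := form_row 1%:M P i; rewrite !mulmx1 => ->; rewrite PP mxE eqxx.
  by rewrite !mulr1 => dE; rewrite dE => /esym.
have key : d * ((u *m B *m u ^t*) 0 0 + (u *m S *m u ^t*) 0 0) = 0.
  have : (u *m (D *m B + S *m D) *m u ^t*) 0 0 = 0.
    have -> : D *m B + S *m D = 0.
      by rewrite /D mulmxBl mulmxBr BA SA addrA subrK subrr.
    by rewrite mulmx0 mul0mx mxE.
  rewrite mulmxDr mulmxDl !mulmxA uD -(mulmxA _ D) Du dR -!scalemxAl -scalemxAr.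
  by rewrite -scalerDr mxE [X in _ * X]mxE.
move/eqP: key; rewrite mulf_eq0 (negPf di0) /= paddr_eq0 //.
case/andP=> /eqP b0 /eqP s0; move: di0; rewrite di /D mulmxBr mulmxBl.
by rewrite mxE [X in _ + X]mxE b0 s0 subrr eqxx.
Qed.

End Modulus.

Section UnitarilyInvariantNorm.
Variables (R : realType) (n : nat).
Implicit Types (N : 'M[R[i]]_n -> R) (U V Y Z : 'M[R[i]]_n).

(* In mx_norm_homog, `|a| lives in R[i] (with zero imaginary part), hence the
   real part. *)
Record is_mx_norm N : Prop := IsMxNorm {
  mx_norm_ge0 : forall Z, 0 <= N Z;
  mx_norm_definite : forall Z, N Z = 0 -> Z = 0;
  mx_norm_homog : forall (a : R[i]) Z,
    N (a *: Z) = complex.Re (`|a| : R[i]) * N Z;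
  mx_norm_triangle : forall Y Z, N (Y + Z) <= N Y + N Z
}.

Definition unitarily_invariant_norm N : Prop :=
  is_mx_norm N /\
  forall U V Z, U \is unitarymx -> V \is unitarymx -> N (U *m Z *m V) = N Z.

End UnitarilyInvariantNorm.

(* Main.v *)
Require Import Defs.
From mathcomp Require Import all_boot all_order all_fingroup all_algebra.
From mathcomp Require Import complex classical_sets reals lra.

(** Upper bound: Z^* Z and Z Z^* have the same characteristic polynomial
    ([char_poly_mulmxC]), hence the same eigenvalues with multiplicity, so their
    square roots |Z| and |Z^*| are unitarily similar ([modulus_adj_similar])
    and have the same norm; the triangle inequality does the rest.

    Lower bound: since |Z^*| is positive semidefinite, it suffices that
    ||A|| <= ||A + B|| for A and B positive semidefinite
    ([ui_norm_psd_le]).  Diagonalising A by a unitary, A becomes diag(a) and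
    the diagonal entries of A + B dominate a.  Conjugating by diagonal sign
    matrices and averaging erases the off-diagonal entries of A + B without
    increasing the norm, and averaging a diagonal matrix with its sign flips
    shrinks its entries down to a.  Both steps use only that a unitarily
    invariant norm does not increase when X is replaced by a convex combination
    of X and U X V ([ui_norm_conv]).

    Sharpness: the operator norm is unitarily invariant.  For the matrix unit
    Z = E_01 one has |Z| = E_11, of operator norm 1, and
    |Z|_sym = (E_11 + E_00) / 2, of operator norm 1/2; hence c <= 1/2.  For
    Z = 1 both moduli are 1; hence C >= 1. *)

Set Implicit Arguments.
Unset Strict Implicit.
Unset Printing Implicit Defensive.

Import Order.TTheory GRing.Theory Num.Theory.
Local Open Scope ring_scope.
Local Open Scope sesquilinear_scope.

(** * Unitary similarity of the two moduli *)

(** With M the block matrix of rows (X, A) and (B, 1), right and left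
    multiplication by triangular block matrices give det M = det (X - AB) and
    X^n det M = X^n det (X - BA); X^n cancels in the polynomial ring. *)
Lemma char_poly_mulmxC (R : idomainType) n (A B : 'M[R]_n) :
  char_poly (A *m B) = char_poly (B *m A).
Proof.
pose Ap := map_mx polyC A; pose Bp := map_mx polyC B.
pose xI : 'M[{poly R}]_n := 'X%:M.
have cpE (X Y : 'M[R]_n) :
    char_poly (X *m Y) = \det (xI - map_mx polyC X *m map_mx polyC Y).
  by rewrite /char_poly /char_poly_mx map_mxM.
rewrite !cpE -/Ap -/Bp; pose M := block_mx xI Ap Bp 1%:M.
have E1 : \det M = \det (xI - Ap *m Bp).
  have : \det (M *m block_mx 1%:M 0 (- Bp) 1%:M) = \det (xI - Ap *m Bp).
    rewrite mulmx_block !mulmx1 !mulmx0 mul1mx add0r mulmxN addrN.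
    by rewrite add0r det_ublock det1 mulr1.
  by rewrite det_mulmx det_lblock !det1 !mulr1.
have E2 : 'X ^+ n * \det M = 'X ^+ n * \det (xI - Bp *m Ap).
  have : \det (block_mx 1%:M 0 (- Bp) xI *m M) = 'X ^+ n * \det (xI - Bp *m Ap).
    rewrite mulmx_block !mul1mx !mul0mx !addr0 mulmx1 [_ *m xI]scalar_mxC.
    by rewrite mulmxN addNr det_ublock det_scalar mulNmx addrC.
  by rewrite det_mulmx det_lblock det1 det_scalar mul1r.
have Xn0 : ('X ^+ n : {poly R}) != 0 by rewrite expf_neq0 ?polyX_eq0.
by apply: (mulfI Xn0); rewrite -E1 E2.
Qed.

Lemma perm_mx_unitary (C : numClosedFieldType) n (s : 'S_n) :
  (perm_mx s : 'M[C]_n) \is unitarymx.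
Proof.
by apply/unitarymxP; rewrite tr_perm_mx map_perm_mx -perm_mxM mulgV perm_mx1.
Qed.

(** Equal characteristic polynomials mean that the spectral diagonals agree up
    to a permutation, so do their entrywise square roots, and W carries one
    eigenbasis to the other through that permutation. *)
Lemma mxsqrt_unitary_similar (C : numClosedFieldType) n (A B : 'M[C]_n) :
    A ^t* = A -> B ^t* = B -> char_poly A = char_poly B ->
  exists2 W, W \is unitarymx & mxsqrt B = W *m mxsqrt A *m W ^t*.
Proof.
move=> hA hB cAB.
have cp (X : 'M[C]_n) : X ^t* = X ->
    char_poly X = \prod_(i < n) ('X - (spectral_diag X 0 i)%:P).
  move=> hX; rewrite {1}(herm_spectral hX) -mulmxA char_poly_mulmxC -mulmxA.
  rewrite (unitarymxP (spectral_unitarymx X)) mulmx1.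
  rewrite char_poly_trig ?diag_mx_is_trig //.
  by apply: eq_bigr => i _; rewrite mxE eqxx.
pose t (X : 'M[C]_n) : n.-tuple C := [tuple spectral_diag X 0 i | i < n].
have : perm_eq (t B) (t A).
  apply: prod_XsubC_eq; rewrite !big_tuple.
  rewrite (eq_bigr (fun i => 'X - (spectral_diag B 0 i)%:P)); last first.
    by move=> i _; rewrite tnth_mktuple.
  rewrite [RHS](eq_bigr (fun i => 'X - (spectral_diag A 0 i)%:P)); last first.
    by move=> i _; rewrite tnth_mktuple.
  by rewrite -!cp.
move=> /tuple_permP[s tBA].
have dE i : spectral_diag B 0 i = spectral_diag A 0 (s i).
  have /(congr1 (fun z : n.-tuple C => tnth z i)) := val_inj tBA.
  by rewrite !tnth_mktuple.
pose P := spectralmx A; pose Q := spectralmx B.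
have uP : P \is unitarymx := spectral_unitarymx A.
have uQ : Q \is unitarymx := spectral_unitarymx B.
exists (Q ^t* *m perm_mx s *m P).
  by rewrite !mul_unitarymx ?trmxC_unitary ?perm_mx_unitary.
rewrite /mxsqrt !invmx_unitary -/P -/Q // !adjM trmxCK !mulmxA.
rewrite !(mulmxtVK _ uP) -[Q^t* *m _ *m _ ]mulmxA -[Q^t* *m _ *m _ ]mulmxA.
congr (_ *m _ *m _).
rewrite tr_perm_mx map_perm_mx -row_permE -col_permE.
apply/matrixP=> i j; rewrite !mxE dE.
by rewrite (inj_eq perm_inj).
Qed.

Lemma modulus_adj_similar (C : numClosedFieldType) n (Z : 'M[C]_n) :
  exists2 W, W \is unitarymx & modulus (Z ^t*) = W *m modulus Z *m W ^t*.
Proof.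
apply: mxsqrt_unitary_similar; last by rewrite trmxCK char_poly_mulmxC.
  by case: (psd_gram Z).
by case: (psd_gram (Z ^t*)).
Qed.

(** * Monotonicity of unitarily invariant norms *)

Section UnitarilyInvariant.
Variables (R : realType) (n : nat) (N : 'M[R[i]]_n -> R).
Hypothesis uiN : unitarily_invariant_norm N.

Lemma ui_norm_conv (a b : R[i]) (Y U V : 'M[R[i]]_n) :
    0 <= a -> 0 <= b -> a + b = 1 -> U \is unitarymx -> V \is unitarymx ->
  N (a *: Y + b *: (U *m Y *m V)) <= N Y.
Proof.
case: uiN => -[_ _ homN triN] invN a0 b0 ab1 uU uV.
apply: le_trans (triN _ _) _; rewrite !homN invN // !ger0_norm //.
by rewrite -mulrDl -raddfD ab1 mul1r.
Qed.

Definition flip_mx (k : 'I_n) : 'M[R[i]]_n :=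
  diag_mx (\row_j (-1) ^+ (j == k)).

Lemma flip_mx_unitary k : flip_mx k \is unitarymx.
Proof.
apply/unitarymxP; rewrite tr_diag_mx map_diag_mx mulmx_diag -diag_const_mx.
congr diag_mx; apply/rowP=> j; rewrite !mxE rmorphXn rmorphN1.
by rewrite -exprMn mulrNN mul1r expr1n.
Qed.

(** Pinching one coordinate at a time: if F flips the sign of coordinate k,
    then (Y + F Y F) / 2 is Y with the off-diagonal part of row and column k
    erased. *)
Lemma ui_norm_pinch (M : 'M[R[i]]_n) : N (diag_mx (\row_i M i i)) <= N M.
Proof.
pose pinch (s : seq 'I_n) := \matrix_(i, j)
  if (i == j) || (i \notin s) && (j \notin s) then M i j else 0.
suff H s : N (pinch s) <= N M.
  rewrite (_ : diag_mx _ = pinch (enum 'I_n)) //.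
  apply/matrixP=> i j; rewrite !mxE !mem_enum /= orbF.
  by case: eqVneq => [->|]; rewrite ?mulr1n ?mulr0n.
elim: s => [|k s IHs].
  rewrite (_ : pinch _ = M) //; apply/matrixP=> i j.
  by rewrite mxE !in_nil orbT.
pose F := flip_mx k; apply: le_trans IHs.
rewrite (_ : pinch _ =
    2^-1 *: pinch s + 2^-1 *: (F *m pinch s *m F)); last first.
  rewrite -scalerDr /F mul_diag_mx mul_mx_diag.
  apply/matrixP=> i j; rewrite !mxE !inE.
  case: (eqVneq i j) => [->|ij] /=.
    rewrite mulrAC -expr2 sqrr_sign mul1r -mulr2n -[M _ _ *+ 2]mulr_natl mulKf //.
    by rewrite pnatr_eq0.
  case: (eqVneq i k) => [ik|] /=; case: (eqVneq j k) => [jk|] /=.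
  - by rewrite ik jk eqxx in ij.
  - by rewrite mulr1 mulN1r subrr mulr0.
  - by rewrite andbF mul1r mulrN1 subrr mulr0.
  rewrite mul1r mulr1; case: ifP => _; last by rewrite addr0 mulr0.
  by rewrite -mulr2n -[M _ _ *+ 2]mulr_natl mulKf // pnatr_eq0.
apply: ui_norm_conv; rewrite ?flip_mx_unitary ?invr_ge0 ?ler0n //.
by rewrite [RHS]splitr mul1r.
Qed.

(** One entry at a time: for 0 <= t <= 1, multiplying the entry b_k by t is the
    convex combination (1 + t)/2, (1 - t)/2 of b and of b with the sign of b_k
    flipped. *)
Lemma ui_norm_diag_le (a b : 'rV[R[i]]_n) :
  (forall i, 0 <= a 0 i <= b 0 i) -> N (diag_mx a) <= N (diag_mx b).
Proof.
move=> ab; pose d (s : seq 'I_n) := \row_i if i \in s then a 0 i else b 0 i.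
suff H s : N (diag_mx (d s)) <= N (diag_mx b).
  rewrite (_ : a = d (enum 'I_n)) //.
  by apply/rowP=> i; rewrite mxE mem_enum.
elim: s => [|k s IHs].
  by rewrite (_ : d _ = b) //; apply/rowP=> i; rewrite mxE.
have [ks|ks] := boolP (k \in s).
  rewrite (_ : d _ = d s) //; apply/rowP=> i; rewrite !mxE inE.
  by case: (eqVneq i k) => // ->; rewrite ks.
apply: le_trans IHs; have /andP[a0 le_ab] := ab k.
(* if b_k = 0 then a_k = 0 as well, and division by zero gives the ratio 0 *)
pose t := a 0 k / b 0 k.
have b0 : 0 <= b 0 k by apply: le_trans le_ab.
have t0 : 0 <= t by rewrite divr_ge0.
have t1 : t <= 1.
  by rewrite /t; have [->|bk0] := eqVneq (b 0 k) 0;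
    rewrite ?invr0 ?mulr0 // ler_pdivrMr ?mul1r // lt_def bk0.
have tb : t * b 0 k = a 0 k.
  rewrite /t; have [bk0|bk0] := eqVneq (b 0 k) 0; last by rewrite divfK.
  by apply/eqP; rewrite bk0 mulr0 eq_le a0 -bk0.
rewrite (_ : diag_mx (d (k :: s)) = ((1 + t) / 2) *: diag_mx (d s) +
    ((1 - t) / 2) *: (flip_mx k *m diag_mx (d s) *m 1%:M)); last first.
  rewrite mulmx1 mulmx_diag -!linearZ -linearD; congr diag_mx.
  apply/rowP=> i; rewrite !mxE inE.
  case: (eqVneq i k) => [->|_] /=.
    rewrite (negPf ks) -tb mulN1r mulrN -mulrBl -mulrBl; congr (_ * _).
    by rewrite opprB addrC addrA subrK -mulr2n -[t *+ 2]mulr_natr mulfK ?pnatr_eq0.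
  rewrite mul1r -mulrDl -mulrDl addrACA subrr addr0 -[1 + 1]/(2%:R).
  by rewrite divff ?pnatr_eq0 // mul1r.
apply: ui_norm_conv.
- by rewrite divr_ge0 ?ler0n ?addr_ge0 ?ler01.
- by rewrite divr_ge0 ?ler0n ?subr_ge0.
- by rewrite -mulrDl addrACA subrr addr0 -[1 + 1]/(2%:R) divff ?pnatr_eq0.
- exact: flip_mx_unitary.
by apply/unitarymxP; rewrite mul1mx trmx1 map_mx1.
Qed.

Lemma ui_norm_conj (P X : 'M[R[i]]_n) :
  P \is unitarymx -> N (P *m X *m P ^t*) = N X.
Proof. by move=> uP; case: uiN => _ -> //; rewrite trmxC_unitary. Qed.

(** In an eigenbasis of A, the diagonal of A + B exceeds the eigenvalues of A
    by the nonnegative diagonal of B. *)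
Lemma ui_norm_psd_le (A B : 'M[R[i]]_n) :
  psdmx A -> psdmx B -> N A <= N (A + B).
Proof.
move=> pA [_ pB]; have [hA _] := pA; pose P := spectralmx A.
have uP : P \is unitarymx := spectral_unitarymx A.
have AE : P *m A *m P ^t* = diag_mx (spectral_diag A).
  rewrite [X in P *m X](herm_spectral hA) -/P !mulmxA (unitarymxP uP) mul1mx.
  by rewrite -mulmxA (unitarymxP uP) mulmx1.
rewrite -[leRHS](ui_norm_conj _ uP); apply: le_trans (ui_norm_pinch _).
rewrite -(ui_norm_conj A uP) AE; apply: ui_norm_diag_le => i.
rewrite spectral_diag_ge0 //= mulmxDr mulmxDl AE !mxE eqxx mulr1n lerDl.
by have := pB (row i P); rewrite form_row mxE.
Qed.

Lemma ui_norm_half (X : 'M[R[i]]_n) : N (2^-1 *: X) = 2^-1 * N X.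
Proof.
case: uiN => -[_ _ homN _] _; rewrite homN.
have -> : (2^-1 : R[i]) = (2^-1 : R)%:C%C by rewrite fmorphV rmorph_nat.
by rewrite ger0_norm // (lecR 0) invr_ge0 ler0n.
Qed.

Lemma ui_norm_modulus_adj Z : N (modulus (Z ^t*)) = N (modulus Z).
Proof. by have [W uW ->] := modulus_adj_similar Z; rewrite ui_norm_conj. Qed.

Lemma ui_norm_sym_modulus Z :
  2^-1 * N (modulus Z) <= N (sym_modulus Z) <= N (modulus Z).
Proof.
have psdM (Y : 'M[R[i]]_n) : psdmx (modulus Y) := mxsqrt_psd (psd_gram Y).
have h0 : 0 < 2^-1 :> R by rewrite invr_gt0 ltr0n.
rewrite /sym_modulus ui_norm_half ler_pM2l // ui_norm_psd_le //=.
rewrite ler_pdivrMl ?ltr0n // mulr_natl mulr2n -{2}(ui_norm_modulus_adj Z).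
by case: uiN => -[].
Qed.

End UnitarilyInvariant.

(** * The operator norm *)

Import ComplexField.Normc.

Section OpNorm.
Variables (R : realType) (n : nat).
Local Notation C := R[i].
Implicit Types (u v : 'rV[C]_n.+1) (Z Y : 'M[C]_n.+1).

Lemma normc_ge0 (z : C) : 0 <= normc z.
Proof. by case: z => a b; exact: sqrtr_ge0. Qed.

Lemma normc_conj (z : C) : normc (z^*) = normc z.
Proof. by apply: (@complexI R); rewrite -[LHS]/`|z^*| norm_conjC. Qed.

Lemma unit_row_sum u : u \is unitarymx -> \sum_i normc (u 0 i) ^+ 2 = 1.
Proof.
move=> /unitarymxP/matrixP/(_ 0 0); rewrite !mxE eqxx => uu.
apply: (@complexI R); rewrite rmorph_sum /= rmorph1 -[RHS]uu.
by apply: eq_bigr => i _; rewrite !mxE -normCK rmorphXn.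
Qed.

Lemma unit_entry_le1 u i : u \is unitarymx -> normc (u 0 i) <= 1.
Proof.
move=> /unit_row_sum; rewrite (bigD1 i) //= => uE.
rewrite -(@ler_pXn2r _ 2) ?nnegrE ?normc_ge0 ?ler01 // expr1n -uE lerDl.
by apply: sumr_ge0 => j _; rewrite sqr_ge0.
Qed.

Lemma unit_entry2_le1 u i j : i != j -> u \is unitarymx ->
  normc (u 0 i) ^+ 2 + normc (u 0 j) ^+ 2 <= 1.
Proof.
move=> ij /unit_row_sum; rewrite (bigD1 i) //= (bigD1 j) 1?eq_sym //= => uE.
rewrite -uE lerD2l lerDl.
by apply: sumr_ge0 => k _; rewrite sqr_ge0.
Qed.

Lemma delta_unitarymx i : (delta_mx 0 i : 'rV[C]_n.+1) \is unitarymx.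
Proof.
apply/unitarymxP; rewrite trmx_delta map_delta_mx mul_delta_mx.
by apply/matrixP=> a b; rewrite !ord1 !mxE.
Qed.

Definition formc u Z v : R := normc ((u *m Z *m v ^t*) 0 0).

Lemma formc_delta i j Z : formc (delta_mx 0 i) Z (delta_mx 0 j) = normc (Z i j).
Proof.
by rewrite /formc trmx_delta map_delta_mx -rowE -colE !mxE.
Qed.

Lemma formcD u Y Z v : formc u (Y + Z) v <= formc u Y v + formc u Z v.
Proof. by rewrite /formc mulmxDr mulmxDl mxE le_normcD. Qed.

Lemma formcZ u a Z v : formc u (a *: Z) v = normc a * formc u Z v.
Proof.
by rewrite /formc -scalemxAr -scalemxAl mxE normcM.
Qed.

(** This makes the supremum defining the operator norm finite; the entries of
    unit vectors are at most 1 in modulus. *)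
Lemma formc_bound u Z v : u \is unitarymx -> v \is unitarymx ->
  formc u Z v <= \sum_j \sum_i normc (Z i j).
Proof.
have le_sum (I : finType) (F : I -> C) :
    normc (\sum_i F i) <= \sum_i normc (F i).
  elim/big_ind2: _ => [|x1 x2 y1 y2 h1 h2|//]; first by rewrite normc0.
  by apply: le_trans (le_normcD _ _) _; rewrite lerD.
move=> uu uv; rewrite /formc mxE; apply: le_trans (le_sum _ _) _.
apply: ler_sum => j _; rewrite normcM !mxE normc_conj.
rewrite (@le_trans _ _ (normc (\sum_i u 0 i * Z i j))) //.
  by rewrite ler_piMr ?normc_ge0 ?unit_entry_le1.
apply: le_trans (le_sum _ _) _; apply: ler_sum => i _.
by rewrite normcM ler_piMl ?normc_ge0 ?unit_entry_le1.
Qed.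

(** The operator norm as the largest modulus of the sesquilinear form of [Z] on
    unit vectors; with this form the triangle inequality and the unitary
    invariance hold vector by vector.  The dimension is positive so that there
    are unit vectors and the supremum is over a nonempty set. *)
Definition opnorm Z : R := sup [set r : R | exists u v,
  [/\ u \is unitarymx, v \is unitarymx & r = formc u Z v]]%classic.

Lemma opnorm_ub u Z v :
  u \is unitarymx -> v \is unitarymx -> formc u Z v <= opnorm Z.
Proof.
move=> uu uv; apply: ub_le_sup; last by exists u, v.
by exists (\sum_j \sum_i normc (Z i j)) => _ [a [b [ua ub ->]]]; exact: formc_bound.
Qed.

Lemma opnorm_le Z x :
  (forall u v, u \is unitarymx -> v \is unitarymx -> formc u Z v <= x) ->
  opnorm Z <= x.
Proof.
move=> H; apply: ge_sup => [|_ [u [v [uu uv ->]]]]; last exact: H.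
exists (formc (delta_mx 0 0) Z (delta_mx 0 0)), (delta_mx 0 0), (delta_mx 0 0).
by rewrite delta_unitarymx.
Qed.

Lemma opnorm_entry Z i j : normc (Z i j) <= opnorm Z.
Proof. by rewrite -formc_delta opnorm_ub ?delta_unitarymx. Qed.

Lemma opnorm_ge0 Z : 0 <= opnorm Z.
Proof. exact: le_trans (normc_ge0 _) (opnorm_entry Z 0 0). Qed.

Lemma opnormZ_le a Z : opnorm (a *: Z) <= normc a * opnorm Z.
Proof.
by apply: opnorm_le => u v uu uv; rewrite formcZ ler_wpM2l ?normc_ge0 ?opnorm_ub.
Qed.

Lemma opnorm_unitary_le U V Z : U \is unitarymx -> V \is unitarymx ->
  opnorm (U *m Z *m V) <= opnorm Z.
Proof.
move=> uU uV; apply: opnorm_le => u v uu uv.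
have -> : formc u (U *m Z *m V) v = formc (u *m U) Z (v *m V ^t*).
  by rewrite /formc adjM trmxCK !mulmxA.
by rewrite opnorm_ub ?mul_unitarymx ?trmxC_unitary.
Qed.

Lemma opnorm_ui : unitarily_invariant_norm opnorm.
Proof.
split=> [|U V Z uU uV]; last first.
  apply/eqP; rewrite eq_le opnorm_unitary_le //=.
  have -> : opnorm Z = opnorm (U ^t* *m (U *m Z *m V) *m V ^t*).
    by rewrite !mulmxA mulmxtVK // (mulmx1C (unitarymxP uU)) mul1mx.
  by rewrite opnorm_unitary_le ?trmxC_unitary.
split.
- exact: opnorm_ge0.
- move=> Z Z0; apply/matrixP=> i j; rewrite mxE; apply: eq0_normc.
  by apply/eqP; rewrite eq_le normc_ge0 -Z0 opnorm_entry.
- move=> a Z; rewrite -[complex.Re _]/(normc a).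
  apply/eqP; rewrite eq_le opnormZ_le /=.
  have [->|a0] := eqVneq a 0.
    by rewrite normc0 mul0r opnorm_ge0.
  have na : 0 < normc a.
    rewrite lt_def normc_ge0 andbT; apply: contra a0 => /eqP.
    by move/eq0_normc->.
  rewrite -ler_pdivlMl // -normcV -{1}[Z](scalerK a0).
  exact: opnormZ_le.
move=> Y Z; apply: opnorm_le => u v uu uv.
by rewrite (le_trans (formcD _ _ _ _)) // lerD ?opnorm_ub.
Qed.

End OpNorm.

(** * Moduli of the extremal matrices *)

Lemma modulus_delta (C : numClosedFieldType) n (i j : 'I_n) :
  modulus (delta_mx i j : 'M[C]_n) = delta_mx j j.
Proof.
have adj (a b : 'I_n) : (delta_mx a b : 'M[C]_n) ^t* = delta_mx b a.
  by rewrite trmx_delta map_delta_mx.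
rewrite /modulus adj mul_delta_mx; apply/esym/mxsqrt_uniq; last exact: mul_delta_mx.
by have := psd_gram (delta_mx j j : 'M[C]_n); rewrite adj mul_delta_mx.
Qed.

Lemma sym_modulus_delta (C : numClosedFieldType) n (i j : 'I_n) :
  sym_modulus (delta_mx i j : 'M[C]_n) = 2^-1 *: (delta_mx j j + delta_mx i i).
Proof.
by rewrite /sym_modulus trmx_delta map_delta_mx !modulus_delta.
Qed.

(** For unit vectors u and v, |u_j v_j| + |u_i v_i| is at most the mean of
    |u_j|^2 + |u_i|^2 and |v_j|^2 + |v_i|^2. *)
Lemma opnorm_delta_add (R : realType) n (i j : 'I_n.+1) : i != j ->
  opnorm (delta_mx j j + delta_mx i i : 'M[R[i]]_n.+1) <= 1.
Proof.
move=> ij; apply: opnorm_le => u v uu uv; apply: le_trans (formcD _ _ _ _) _.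
have formcE k : formc u (delta_mx k k) v =
    normc (u 0 k) * normc (v 0 k).
  rewrite -(mul_delta_mx (0 : 'I_1)) /formc !mulmxA -colE -mulmxA -rowE.
  by rewrite mxE big_ord1 !mxE normcM normc_conj.
rewrite !formcE.
have := unit_entry2_le1 ij uu; have := unit_entry2_le1 ij uv.
have := sqr_ge0 (normc (u 0 i) - normc (v 0 i)).
have := sqr_ge0 (normc (u 0 j) - normc (v 0 j)).
by rewrite !sqrrB; lra.
Qed.

Lemma modulus1 (C : numClosedFieldType) n : modulus (1%:M : 'M[C]_n) = 1%:M.
Proof.
have adj1 : (1%:M : 'M[C]_n) ^t* = 1%:M by rewrite trmx1 map_mx1.
rewrite /modulus adj1 mulmx1; apply/esym/mxsqrt_uniq; last exact: mulmx1.
by have := psd_gram (1%:M : 'M[C]_n); rewrite adj1 mulmx1.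
Qed.

Theorem theorem1p1 (R : realType) (n : nat) (n_ge2 : (2 <= n)%N) :
  [/\ forall N : 'M[R[i]]_n -> R, unitarily_invariant_norm N ->
        forall Z : 'M[R[i]]_n,
          2^-1 * N (modulus Z) <= N (sym_modulus Z) <= N (modulus Z),
      forall c : R,
        (forall N : 'M[R[i]]_n -> R, unitarily_invariant_norm N ->
           forall Z : 'M[R[i]]_n, c * N (modulus Z) <= N (sym_modulus Z)) ->
        c <= 2^-1
    & forall C : R,
        (forall N : 'M[R[i]]_n -> R, unitarily_invariant_norm N ->
           forall Z : 'M[R[i]]_n, N (sym_modulus Z) <= C * N (modulus Z)) ->
        1 <= C].
Proof.
case: n n_ge2 => [|[|n]] // _; split=> [N uiN Z|c cP|C CP].
- exact: ui_norm_sym_modulus.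
- pose j1 : 'I_n.+2 := lift ord0 ord0.
  have := cP _ (opnorm_ui R n.+1) (delta_mx 0 j1).
  rewrite sym_modulus_delta modulus_delta (ui_norm_half (opnorm_ui _ _)) => cE.
  have E1 := opnorm_entry (delta_mx j1 j1 : 'M[R[i]]_n.+2) j1 j1.
  rewrite mxE !eqxx normc1 in E1.
  have /opnorm_delta_add-/(_ R) E2 : 0 != j1 by [].
  have [c0|/ltW c0] := leP c 0; first by apply: le_trans c0 _; rewrite invr_ge0.
  rewrite -[leRHS]mulr1; apply: (@le_trans _ _ (c * opnorm (delta_mx j1 j1))).
    by rewrite ler_peMr.
  by apply: le_trans cE _; rewrite ler_pM2l // invr_gt0.
have := CP _ (opnorm_ui R n.+1) 1%:M.
rewrite /sym_modulus trmx1 map_mx1 modulus1 -mulr2n -[_%:M *+ 2]scaler_nat scalerA.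
rewrite mulVf ?pnatr_eq0 // scale1r => CE.
have E1 := opnorm_entry (1%:M : 'M[R[i]]_n.+2) 0 0.
rewrite mxE eqxx normc1 in E1.
by rewrite -(ler_pM2r (lt_le_trans ltr01 E1)) mul1r.
Qed.
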